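(* $\textsc{Empty-Child}\le_{dt}\textsc{Nephew}$.
   Context: Query model: inputs consist of functions between finite sets, accessed by querying bits of the binary encodings of their values. $R\le_{dt}S$ means each instance of $R$ (size parameter $N$) reduces to an instance of $S$ whose input bits are computed by decision trees over the $R$-input and whose solutions are mapped back to solutions of $R$ by decision trees, with log of the $S$-input length plus maximum decision-tree depth at most $\mathrm{polylog}(N)$. $\textsc{Empty-Child}$: given $V=[N]$ and $F,L,R:V\to V$, a solution is (s1) $u\in V$ with $F(L(u))\neq u$ or $F(R(u))\neq u$ or $L(u)=R(u)\neq u$, or (s2) the vertex $1$ if $L(1)=1$ or $R(1)=1$ or $F(1)\neq1$. $\textsc{Nephew}$: given a finite set $V$ and $f,g:V\to V$, a solution is any $u\in V$ with $f(f(g(u)))\neq f(u)$ or $f(g(u))=u$. *)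

(* Defs.v *)
From HB Require Import structures.
From mathcomp Require Import all_boot.

Set Implicit Arguments.
Unset Strict Implicit.
Unset Printing Implicit Defensive.

(** * Query inputs *)

Record input_shape := InputShape {
  fname : finType;
  fdom : fname -> finType;
  fcod : fname -> finType }.

Definition input (s : input_shape) : Type :=
  forall i : fname s, fdom i -> fcod i.

(* An element of T is encoded by the ceil(log2 #|T|) binary digits of its rank
   in the enumeration of T. *)
Definition width (T : finType) : nat := up_log 2 #|T|.

(* A queryable position: a function name, an argument, and the index of a bit
   (0 = least significant) of the value there. *)
Definition bitpos (s : input_shape) : finType :=
  {i : fname s & (fdom i * 'I_(width (fcod i)))%type}.

Definition read (s : input_shape) (x : input s) (p : bitpos s) : bool :=
  odd (enum_rank (x (tag p) (tagged p).1) %/ 2 ^ (tagged p).2).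

Definition input_length (s : input_shape) : nat := #|bitpos s|.

(** * Decision trees *)

Inductive dtree (Q A : Type) : Type :=
| Leaf of A
| Query of Q & dtree Q A & dtree Q A.

Fixpoint depth (Q A : Type) (t : dtree Q A) : nat :=
  match t with
  | Leaf _ => 0
  | Query _ t0 t1 => (maxn (depth t0) (depth t1)).+1
  end.

Fixpoint eval (Q A : Type) (x : Q -> bool) (t : dtree Q A) : A :=
  match t with
  | Leaf a => a
  | Query q t0 t1 => if x q then eval x t1 else eval x t0
  end.

(** * Query search problems and decision-tree reductions *)

Record search_problem := SearchProblem {
  instance : Type;
  param : instance -> nat;
  shape : instance -> input_shape;
  solution : instance -> Type;
  is_solution : forall n : instance, input (shape n) -> solution n -> Prop }.

(* The input y of S is the one whose bits are output by the trees enc; its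
   existence says that these bits always encode functions with values in the
   prescribed codomains, which matters when a codomain does not have 2 ^ w
   elements.  It is unique, since the binary encoding is injective. *)
Definition dt_reduction (R S : search_problem) (n : instance R) (m : instance S)
    (enc : bitpos (shape m) -> dtree (bitpos (shape n)) bool)
    (dec : solution m -> dtree (bitpos (shape n)) (solution n)) : Prop :=
  forall x : input (shape n),
  exists2 y : input (shape m),
    forall p, read y p = eval (read x) (enc p) &
    forall o, is_solution y o -> is_solution x (eval (read x) (dec o)).

(* The additive k in the polylogarithmic bound covers param n = 1, where the
   logarithm vanishes. *)
Definition dt_reducible (R S : search_problem) : Prop :=
  exists k : nat, forall n : instance R,
  exists (m : instance S)
         (enc : bitpos (shape m) -> dtree (bitpos (shape n)) bool)
         (dec : solution m -> dtree (bitpos (shape n)) (solution n))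
         (d : nat),
    [/\ dt_reduction enc dec,
        forall p, depth (enc p) <= d,
        forall o, depth (dec o) <= d &
        up_log 2 (input_length (shape m)) + d
          <= k * up_log 2 (param n) ^ k + k].

Notation "R <=dt S" := (dt_reducible R S) (at level 70, no associativity).

Definition endo_shape (names V : finType) : input_shape :=
  @InputShape names (fun=> V) (fun=> V).

(** * Empty-Child *)

Inductive ec_name := ecF | ecL | ecR.

Definition ec_name_code (a : ec_name) : 'I_3 :=
  match a with ecF => inord 0 | ecL => inord 1 | ecR => inord 2 end.

Definition ec_name_decode (i : 'I_3) : ec_name :=
  match val i with 0 => ecF | 1 => ecL | _ => ecR end.

Lemma ec_name_codeK : cancel ec_name_code ec_name_decode.
Proof. by case; rewrite /ec_name_decode /= inordK. Qed.

HB.instance Definition _ := Finite.copy ec_name (can_type ec_name_codeK).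

(* The vertex set [N] = {1, ..., N} with N >= 1 is 'I_n.+1, where N = n.+1;
   the vertex 1 is ord0. *)
Definition empty_child_sol (n : nat)
    (x : input (endo_shape ec_name 'I_n.+1)) (u : 'I_n.+1) : Prop :=
  let F : 'I_n.+1 -> 'I_n.+1 := x ecF in
  let L : 'I_n.+1 -> 'I_n.+1 := x ecL in
  let R : 'I_n.+1 -> 'I_n.+1 := x ecR in
  let root : 'I_n.+1 := ord0 in
  (F (L u) <> u \/ F (R u) <> u \/ (L u = R u /\ R u <> u)) \/
  (u = root /\ (L root = root \/ R root = root \/ F root <> root)).

Definition Empty_Child : search_problem :=
  @SearchProblem nat (fun n => n.+1) (fun n => endo_shape ec_name 'I_n.+1)
    (fun n => 'I_n.+1) empty_child_sol.

(** * Nephew *)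

Inductive nephew_name := nephew_f | nephew_g.

Definition nephew_name_code (a : nephew_name) : bool :=
  match a with nephew_f => false | nephew_g => true end.

Definition nephew_name_decode (b : bool) : nephew_name :=
  if b then nephew_g else nephew_f.

Lemma nephew_name_codeK : cancel nephew_name_code nephew_name_decode.
Proof. by case. Qed.

HB.instance Definition _ :=
  Finite.copy nephew_name (can_type nephew_name_codeK).

(* V must be nonempty: over the empty set Nephew has no solution, so every
   problem would vacuously reduce to that instance. *)
Definition nephew_instance : Type := {V : finType | 0 < #|V|}.

Definition nephew_sol (I : nephew_instance)
    (x : input (endo_shape nephew_name (sval I))) (u : sval I) : Prop :=
  let f : sval I -> sval I := x nephew_f in
  let g : sval I -> sval I := x nephew_g in
  f (f (g u)) <> f u \/ f (g u) = u.

Definition Nephew : search_problem :=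
  @SearchProblem nephew_instance (fun I => #|sval I|)
    (fun I => endo_shape nephew_name (sval I)) (fun I => sval I) nephew_sol.

(* Main.v *)
(** Let [f u := F u], unless [F u] is isolated ([L] and [R] both fix it), in
    which case [f u] is the root.  Away from solutions, [p := f u] has two
    distinct children; let [s] be one that differs from [u], preferably [R p],
    and let [g u := L s].  Then [f s = F s = p] and [f (L s) = s], so that
    [L s] is a nephew of [u]: if [s] were isolated, then [p = F s = s] would
    be isolated as well.  This argument inspects only the root, [p] and [s],
    so when [u] solves Nephew one of these three solves Empty-Child. *)

Require Import Defs.
From mathcomp Require Import all_boot.
From mathcomp Require Import zify.

Set Implicit Arguments.
Unset Strict Implicit.
Unset Printing Implicit Defensive.

(** * Composing decision trees and reading whole values from their bits *)

Fixpoint dbind (Q A B : Type) (t : dtree Q A) (k : A -> dtree Q B) :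
    dtree Q B :=
  match t with
  | Leaf a => k a
  | Query q t0 t1 => Query q (dbind t0 k) (dbind t1 k)
  end.

Lemma eval_dbind (Q A B : Type) (x : Q -> bool) (t : dtree Q A)
    (k : A -> dtree Q B) :
  eval x (dbind t k) = eval x (k (eval x t)).
Proof. by elim: t => //= q t0 -> t1 ->; case: (x q). Qed.

Lemma depth_dbind (Q A B : Type) (t : dtree Q A) (k : A -> dtree Q B) d1 d2 :
  depth t <= d1 -> (forall a, depth (k a) <= d2) ->
  depth (dbind t k) <= d1 + d2.
Proof.
move=> td1 kd2; apply: leq_trans (leq_add td1 (leqnn d2)).
elim: t {td1} => [a|q t0 IH0 t1 IH1] //=.
by rewrite addSn ltnS geq_max; apply/andP; split;
  [apply: leq_trans IH0 _ | apply: leq_trans IH1 _];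
  rewrite leq_add2r ?leq_maxl ?leq_maxr.
Qed.

Fixpoint query_all (Q : Type) (s : seq Q) : dtree Q (seq bool) :=
  if s is q :: s' then
    Query q (dbind (query_all s') (fun bs => Leaf _ (false :: bs)))
            (dbind (query_all s') (fun bs => Leaf _ (true :: bs)))
  else Leaf _ [::].

Lemma eval_query_all (Q : Type) (x : Q -> bool) (s : seq Q) :
  eval x (query_all s) = map x s.
Proof.
by elim: s => //= q s <-; case xq: (x q); rewrite eval_dbind /= ?xq.
Qed.

Lemma depth_query_all (Q : Type) (s : seq Q) : depth (query_all s) <= size s.
Proof.
elim: s => //= q s IH; rewrite ltnS geq_max -[size s]addn0.
by rewrite !depth_dbind.
Qed.

(** Halving both numbers shifts the bit index by one, so the induction hypothesis equates the
    halves; bit 0 then settles the parity. *)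
Lemma binary_inj w m n : m < 2 ^ w -> n < 2 ^ w ->
  (forall j, j < w -> odd (m %/ 2 ^ j) = odd (n %/ 2 ^ j)) -> m = n.
Proof.
elim: w m n => [|w IH] m n; first by rewrite expn0; lia.
rewrite expnS => mw nw mn.
have half : m %/ 2 = n %/ 2.
  apply: IH => [||j jw]; [lia | lia |].
  by rewrite -!divnMA -expnS mn.
have := mn 0 isT; rewrite expn0 !divn1 => odd_mn.
by rewrite -(odd_double_half m) -(odd_double_half n) -!divn2 half odd_mn.
Qed.

(** Bits are listed in the order in which [read_value] queries their positions, so its answers form
    the code of the value at the argument. *)
Definition code (T : finType) (v : T) : seq bool :=
  [seq odd (enum_rank v %/ 2 ^ j) | j : 'I_(width T)].

Lemma code_inj (T : finType) : injective (@code T).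
Proof.
move=> u v /eq_in_map uv; apply/enum_rank_inj/val_inj.
have rank_lt (t : T) : enum_rank t < 2 ^ width T.
  by apply: leq_trans (ltn_ord _) _; exact: up_logP.
apply: binary_inj (rank_lt u) (rank_lt v) _ => j jw.
by apply: (uv (Ordinal jw)); rewrite mem_enum.
Qed.

(** The default [v0] is returned only on bit strings that code no element, which never arise from an
    actual input. *)
Definition decode (T : finType) (v0 : T) (bs : seq bool) : T :=
  odflt v0 [pick v | code v == bs].

Lemma codeK (T : finType) (v0 : T) : cancel (@code T) (decode v0).
Proof.
by move=> v; rewrite /decode; case: pickP => [u /eqP/code_inj|/(_ v)/eqP].
Qed.

Section ReadValue.
Variables (s : input_shape) (i : fname s).

Definition read_value (v0 : fcod i) (a : fdom i) : dtree (bitpos s) (fcod i) :=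
  dbind (query_all [seq (Tagged (fun i => (fdom i * 'I_(width (fcod i)))%type)
                          (a, j) : bitpos s) | j : 'I_(width (fcod i))])
        (fun bs => Leaf _ (decode v0 bs)).

Lemma eval_read_value (x : input s) (v0 : fcod i) (a : fdom i) :
  eval (read x) (read_value v0 a) = x i a.
Proof. by rewrite eval_dbind eval_query_all -map_comp; exact: (codeK v0 (x i a)). Qed.

Lemma depth_read_value (v0 : fcod i) (a : fdom i) :
  depth (read_value v0 a) <= width (fcod i).
Proof.
rewrite -[leqRHS]addn0; apply: depth_dbind => //.
apply: leq_trans (depth_query_all _) _.
by rewrite size_map -cardE card_ord.
Qed.

End ReadValue.

(** * The Nephew instance on the same vertex set *)

Section EmptyChildToNephew.
Variable n : nat.
Notation V := 'I_n.+1.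
Notation s := (endo_shape ec_name V).
Notation T := (dtree (bitpos s)).
Notation w := (width V).

Section Reference.
Variable x : input s.
Let F : V -> V := @x ecF.
Let L : V -> V := @x ecL.
Let R : V -> V := @x ecR.

Definition father (u : V) : V :=
  if (L (F u) == F u) && (R (F u) == F u) then ord0 else F u.

Definition sibling (u : V) : V :=
  if u == R (father u) then L (father u) else R (father u).

Definition nephew (u : V) : V := L (sibling u).

Definition ec_solb (u : V) : bool :=
  [|| F (L u) != u, F (R u) != u, (L u == R u) && (R u != u) |
      (u == ord0) && [|| L u == u, R u == u | F u != u]].

Lemma ec_solP u : reflect (empty_child_sol x u) (ec_solb u).
Proof.
apply: (iffP idP); rewrite /empty_child_sol -/F -/L -/R.
- case/or4P => [/eqP|/eqP|/andP[/eqP ? /eqP ?]|/andP[/eqP-> /or3P]]; try tauto.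
  by case=> /eqP; tauto.
- rewrite /ec_solb; case=> [|[-> H]]; last first.
    by rewrite eqxx; case: H => [->|[->|/eqP->]]; rewrite ?eqxx ?orbT.
  by case=> [/eqP->|[/eqP->|[-> /eqP->]]]; rewrite ?eqxx ?orbT.
Qed.

Lemma sibling_or_solution u :
  father (nephew u) = sibling u /\ father (sibling u) = father u
    /\ sibling u <> u \/
  [|| ec_solb ord0, ec_solb (father u) | ec_solb (sibling u)].
Proof.
case: (boolP [|| _, _ | _]) => [|nsol]; [by right | left].
(* The last clause turns [L 1 <> 1] into the statement that the root is not isolated. *)
have nsolP v : ~~ ec_solb v ->
    [/\ F (L v) = v, F (R v) = v, L v = R v -> R v = v &
        v = ord0 -> ~~ ((L v == v) && (R v == v))].
  rewrite !negb_or !negbK !negb_and negbK.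
  case/and4P=> /eqP ? /eqP ? LR root; split=> // [LRv|v0].
    by move: LR; rewrite LRv eqxx => /eqP.
  move: root; rewrite {1}v0 eqxx /= !negb_or => /and3P[Lv _ _].
  by rewrite Lv.
case/norP: nsol => /nsolP[_ _ _ /(_ erefl) root_niso] /norP[].
(* Either [father u] is the root, which is not isolated, or it is [F u] and failed the isolation
   test. *)
have {root_niso} : ~~ ((L (father u) == father u) && (R (father u) == father u)).
  by rewrite {1 2 3 4}/father; case: ifP => // ->.
(* Once this equation is recorded, [father u] and [sibling u] can be generalized to [p] and [v]. *)
have : sibling u = if u == R (father u) then L (father u) else R (father u) by [].
rewrite /nephew; move: (father u) (sibling u) => p v def_v p_niso.
case/nsolP => FLp FRp LRp _ /nsolP[FLv FRv LRv _].
have Fv : F v = p by rewrite def_v; case: ifP.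
have v_niso : ~~ ((L v == v) && (R v == v)).
  apply: contra p_niso => v_iso; suff <- : v = p by [].
  by case/andP: v_iso => /eqP Lv _; rewrite -Fv -{2}Lv FLv.
rewrite /father FLv Fv (negPf v_niso) (negPf p_niso); split=> //; split=> //.
(* If [u = R p] and [v = L p] equals [u], then [L p = R p]; as [p] is not a solution, both equal
   [p], making [p] isolated. *)
rewrite def_v; case: eqP => [-> LR|uR /esym //].
by move: p_niso; rewrite LR LRp ?eqxx.
Qed.

End Reference.

(** * Decision trees computing these functions, and their depths *)

Definition father_tree (u : V) : T V :=
  dbind (@read_value s ecF ord0 u) (fun v =>
  dbind (@read_value s ecL ord0 v) (fun l =>
  dbind (@read_value s ecR ord0 v) (fun r =>
  Leaf _ (if (l == v) && (r == v) then ord0 else v)))).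

Definition sibling_tree (u : V) : T V :=
  dbind (father_tree u) (fun p =>
  dbind (@read_value s ecL ord0 p) (fun l =>
  dbind (@read_value s ecR ord0 p) (fun r =>
  Leaf _ (if u == r then l else r)))).

Definition nephew_tree (u : V) : T V :=
  dbind (sibling_tree u) (@read_value s ecL ord0).

Definition ec_sol_tree (u : V) : T bool :=
  dbind (@read_value s ecF ord0 u) (fun v =>
  dbind (@read_value s ecL ord0 u) (fun l =>
  dbind (@read_value s ecR ord0 u) (fun r =>
  dbind (@read_value s ecF ord0 l) (fun fl =>
  dbind (@read_value s ecF ord0 r) (fun fr =>
  Leaf _ [|| fl != u, fr != u, (l == r) && (r != u) |
             (u == ord0) && [|| l == u, r == u | v != u]]))))).

(** The candidate [v] is returned untested: if [u] solves Nephew and the other two candidates fail,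
    [v] must be a solution. *)
Definition solution_tree (u : V) : T V :=
  dbind (father_tree u) (fun p =>
  dbind (sibling_tree u) (fun v =>
  dbind (ec_sol_tree ord0) (fun root_sol =>
  dbind (ec_sol_tree p) (fun p_sol =>
  Leaf _ (if root_sol then ord0 else if p_sol then p else v))))).

Lemma eval_father_tree x u : eval (read x) (father_tree u) = father x u.
Proof. by rewrite !(eval_dbind, eval_read_value). Qed.

Lemma eval_sibling_tree x u : eval (read x) (sibling_tree u) = sibling x u.
Proof. by rewrite !(eval_dbind, eval_read_value, eval_father_tree). Qed.

Lemma eval_nephew_tree x u : eval (read x) (nephew_tree u) = nephew x u.
Proof. by rewrite eval_dbind eval_read_value eval_sibling_tree. Qed.

Lemma eval_ec_sol_tree x u : eval (read x) (ec_sol_tree u) = ec_solb x u.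
Proof. by rewrite !(eval_dbind, eval_read_value). Qed.

Lemma eval_solution_tree x u : eval (read x) (solution_tree u) =
  if ec_solb x ord0 then ord0
  else if ec_solb x (father x u) then father x u else sibling x u.
Proof.
by rewrite !(eval_dbind, eval_father_tree, eval_sibling_tree, eval_ec_sol_tree).
Qed.

(** The bound mirrors the nesting of the binds, with 0 for the leaf, so that [depth_dbind] applies
    syntactically. *)
Lemma depth_father_tree u : depth (father_tree u) <= w + (w + (w + 0)).
Proof. by do !(apply: depth_dbind => [|?]; first exact: depth_read_value). Qed.

Lemma depth_sibling_tree u :
  depth (sibling_tree u) <= w + (w + (w + 0)) + (w + (w + 0)).
Proof.
apply: depth_dbind => [|p]; first exact: depth_father_tree.
by do !(apply: depth_dbind => [|?]; first exact: depth_read_value).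
Qed.

Lemma depth_nephew_tree u : depth (nephew_tree u) <= 6 * w.
Proof.
have -> : 6 * w = w + (w + (w + 0)) + (w + (w + 0)) + w by lia.
apply: depth_dbind => [|v]; first exact: depth_sibling_tree.
exact: depth_read_value.
Qed.

Lemma depth_ec_sol_tree u :
  depth (ec_sol_tree u) <= w + (w + (w + (w + (w + 0)))).
Proof. by do !(apply: depth_dbind => [|?]; first exact: depth_read_value). Qed.

Lemma depth_solution_tree u : depth (solution_tree u) <= 18 * w.
Proof.
(* Three reads find [p], five find [v], and each of the two tests takes five: 18 in total. *)
apply: leq_trans (_ : _ <= 3 * w + (5 * w + (5 * w + (5 * w + 0)))) _;
  last by lia.
apply: depth_dbind => [|p]; first by have := depth_father_tree u; lia.
apply: depth_dbind => [|v]; first by have := depth_sibling_tree u; lia.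
apply: depth_dbind => [|b]; first by have := depth_ec_sol_tree ord0; lia.
by apply: depth_dbind => [|c]; first by have := depth_ec_sol_tree p; lia.
Qed.

Definition value_tree (i : nephew_name) : V -> T V :=
  if i is nephew_f then father_tree else nephew_tree.

Lemma depth_value_tree i u : depth (value_tree i u) <= 18 * w.
Proof.
case: i; first by have := depth_father_tree u; rewrite /=; lia.
by have := depth_nephew_tree u; rewrite /=; lia.
Qed.

(** The whole value is computed before one bit is extracted, so the output bits always encode a
    vertex, even when the number of vertices is not a power of two. *)
Definition bit_tree (p : bitpos (endo_shape nephew_name V)) : T bool :=
  dbind (value_tree (tag p) (tagged p).1) (fun v =>
  Leaf _ (odd (enum_rank v %/ 2 ^ (tagged p).2))).

Lemma depth_bit_tree p : depth (bit_tree p) <= 18 * w.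
Proof.
by rewrite -[leqRHS]addn0; apply: depth_dbind => //; exact: depth_value_tree.
Qed.

Definition nephew_input (x : input s) : input (endo_shape nephew_name V) :=
  fun i => if i is nephew_f then father x else nephew x.

Lemma read_nephew_input x p :
  read (nephew_input x) p = eval (read x) (bit_tree p).
Proof.
rewrite eval_dbind /=; case: p => [[] [u j]];
by rewrite /= ?eval_father_tree ?eval_nephew_tree.
Qed.

Lemma card_ord_gt0 : 0 < #|V|. Proof. by rewrite card_ord. Qed.

Definition target : nephew_instance := exist (fun V : finType => 0 < #|V|) V card_ord_gt0.

(** The first alternative of [sibling_or_solution] contradicts both clauses of a Nephew solution,
    which leaves the second. *)
Lemma nephew_sol_sound x u :
  @nephew_sol target (nephew_input x) u ->
  empty_child_sol x (eval (read x) (solution_tree u)).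
Proof.
rewrite /nephew_sol /= eval_solution_tree => neph; apply/ec_solP.
case: (sibling_or_solution x u) => [[fn [fs su]]|].
  by case: neph; rewrite fn ?fs.
by case: ifP => // _ /=; case: ifP.
Qed.

End EmptyChildToNephew.

(** * Input length and the polylogarithmic bound *)

Lemma input_length_endo (names V : finType) :
  input_length (endo_shape names V) = #|names| * (#|V| * width V).
Proof.
rewrite /input_length card_tagged -sum1_card big_distrl /= sumnE big_map.
rewrite big_enum; apply: eq_bigr => i _.
by rewrite card_prod card_ord mul1n.
Qed.

Lemma card_nephew_name : #|{: nephew_name}| = 2.
Proof. by rewrite -card_bool; apply: (bij_eq_card (f := nephew_name_code));
  exists nephew_name_decode; [exact: nephew_name_codeK | case]. Qed.

Lemma up_log_input_length (names V : finType) :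
  up_log 2 (input_length (endo_shape names V))
    <= up_log 2 #|names| + 2 * width V.
Proof.
rewrite input_length_endo; apply: up_log_min => //.
(* Both [#|V|] and [width V] are at most [2 ^ width V], whence the factor 2. *)
rewrite expnD mul2n -addnn expnD leq_mul ?up_logP // leq_mul ?up_logP //.
by rewrite ltnW // ltn_expl.
Qed.

Theorem theorem1p7 : Empty_Child <=dt Nephew.
Proof.
(* With [W] the width, log-length is at most [1 + 2 * W] and depth [18 * W]; the sum [20 * W + 1] is
   at most [20 * W ^ 20 + 20]. *)
exists 20 => n; exists (target n), (@bit_tree n), (@solution_tree n).
exists (18 * width 'I_n.+1); split=> [x|||].
- exists (nephew_input x) => [p|u]; first exact: read_nephew_input.
  exact: nephew_sol_sound.
- exact: depth_bit_tree.
- exact: depth_solution_tree.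
have := up_log_input_length nephew_name 'I_n.+1.
rewrite card_nephew_name up_lognn // /width card_ord /=.
set W := up_log 2 n.+1 => len.
have : W <= W ^ 20 by case: (W) => // m; rewrite -[leqLHS]expn1 leq_pexp2l.
lia.
Qed.
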